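(* Let $F(z)=zM+D+B^T(zI_n-A)^{-1}B\in\mathcal{PRO}_m$, where $n\ge 0$ is an integer, $M,D\in\mathbb{R}^{m\times m}$, $B\in\mathbb{R}^{n\times m}$, $A\in\mathbb{R}^{n\times n}$, $M\ge 0$, $A^T=-A$, $D^T=-D$ and $(A,B)$ is controllable. Decompose $B$, $D$, $M$ with respect to $\mathbb{R}^m=\mathcal{X}_1\oplus\mathcal{X}_2\oplus\mathcal{X}_3$ as in the context. Assume $\det F(z)\not\equiv 0$. Then $$F(z)^{-1}=zM_{\rm inv}+D_{\rm inv}+B_{\rm inv}^T(zI_k-A_{\rm inv})^{-1}B_{\rm inv},$$ where $k=n+m_1-m_3$, the matrices $A_{\rm inv}$, $B_{\rm inv}$, $K_{\rm inv}$, $D_{\rm inv}$ are as defined in the context and $M_{\rm inv}=K_{\rm inv}^TK_{\rm inv}$. Moreover, the pair $(A_{\rm inv},B_{\rm inv})$ is controllable.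
   Context: For a square matrix $K$, $\mathrm{Re}(K)=\frac12(K+K^* )$ and $K\ge 0$ means positive semidefinite. $\mathcal{PRO}_m$ is the class of $m\times m$ rational matrix functions $F$ with $\mathrm{Re}(F(z))\ge 0$ for $\mathrm{Re}(z)>0$, $F(t)\in\mathbb{R}^{m\times m}$ for $t\in\mathbb{R}$ not a pole, and $-F(z)=F(-\overline z)^*$ for $z$ not a pole of $F$. (Every $F$ of the stated form lies in $\mathcal{PRO}_m$ and every element of $\mathcal{PRO}_m$ has this form.) $(A,B)$ is controllable if $[B\ AB\ \cdots\ A^{n-1}B]$ has rank $n$, $n$ being the size of $A$. Decomposition: $\mathbb{R}^m=\mathcal{X}_1\oplus\mathcal{X}_2\oplus\mathcal{X}_3$ (orthogonal), with $\mathcal{X}_1=(\ker M)^\perp$, $\mathcal{X}_3=\ker(P_{\ker M}D|_{\ker M})\subset\ker M$, and $\mathcal{X}_2$ the orthogonal complement of $\mathcal{X}_3$ in $\ker M$; here $P_{\ker M}$ is the orthogonal projection onto $\ker M$. With respect to this decomposition $$B=\begin{bmatrix}B_1&B_2&B_3\end{bmatrix},\quad D=\begin{bmatrix}D_{11}&D_{12}&D_{13}\\ -D_{12}^T&D_{22}&0\\ -D_{13}^T&0&0\end{bmatrix},\quad M=\begin{bmatrix}M_1&0&0\\ 0&0&0\\ 0&0&0\end{bmatrix},$$ with $M_1$ positive definite and $D_{22}$ invertible and skew-symmetric. Put $m_i=\dim\mathcal{X}_i$ ($m_2$ is even). Let $K_1:\mathcal{X}_1\to\mathbb{R}^{m_1}$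 and $\Xi:\mathcal{X}_3\to\mathbb{R}^{m_3}$ be linear maps with $K_1^TK_1=M_1$ and $\Xi^T\Xi=I_{\mathcal{X}_3}$ (so $K_1$ is invertible and $\Xi$ orthogonal); $K_1^{-T}=(K_1^{-1})^T$. Define $$\widetilde{A}=\begin{bmatrix}A-B_2D_{22}^{-1}B_2^T&(B_1+B_2D_{22}^{-1}D_{12}^T)K_1^{-1}\\ K_1^{-T}(-B_1^T+D_{12}D_{22}^{-1}B_2^T)&-K_1^{-T}(D_{11}+D_{12}D_{22}^{-1}D_{12}^T)K_1^{-1}\end{bmatrix},\quad \widetilde{B}=\begin{bmatrix}B_3\Xi^T\\ -K_1^{-T}D_{13}\Xi^T\end{bmatrix}.$$ The condition $\det F(z)\not\equiv0$ is equivalent to $\ker\widetilde{B}=\{0\}$. Let $\Gamma\in\mathbb{R}^{(n+m_1)\times k}$, $k=n+m_1-m_3$, be an isometry with $\mathrm{Im}\,\Gamma\perp\mathrm{Im}\,\widetilde{B}$, and put $$\Phi_{33}=B_3^TB_3+D_{13}^TM_1^{-1}D_{13},\qquad \Phi_{23}=B_2^TB_3+D_{12}^TM_1^{-1}D_{13},$$ $$A_{\rm inv}=\Gamma^T\widetilde{A}\,\Gamma,\qquad K_{\rm inv}=\begin{bmatrix}0&0&-\Xi\,\Phi_{33}^{-1/2}\end{bmatrix},$$ $$B_{\rm inv}=\Gamma^T\begin{bmatrix} 0 & B_2D_{22}^{-1} & (AB_3-B_1M_1^{-1}D_{13}-B_2D_{22}^{-1}\Phi_{23})\Phi_{33}^{-1}\\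 K_1^{-T} & -K_1^{-T}D_{12}D_{22}^{-1} & -K_1^{-T}(B_1^TB_3-D_{11}M_1^{-1}D_{13}-D_{12}D_{22}^{-1}\Phi_{23})\Phi_{33}^{-1}\end{bmatrix},$$ $$D_{\rm inv}=\begin{bmatrix} 0 & 0 & -M_1^{-1}D_{13}\Phi_{33}^{-1}\\ 0 & D_{22}^{-1} & -D_{22}^{-1}\Phi_{23}\Phi_{33}^{-1}\\ \Phi_{33}^{-1}D_{13}^TM_1^{-1} & -\Phi_{33}^{-1}\Phi_{23}^TD_{22}^{-1} & -\Phi_{33}^{-1}\,\Xi^T\widetilde{B}^T\widetilde{A}\widetilde{B}\,\Xi\,\Phi_{33}^{-1}\end{bmatrix}.$$ Block columns with domain $\mathbb{R}^m$ and the blocks of $D_{\rm inv}$ are with respect to $\mathcal{X}_1\oplus\mathcal{X}_2\oplus\mathcal{X}_3$. *)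

(* Defs.v *)
From mathcomp Require Import all_boot all_order all_algebra.
From mathcomp Require Import complex reals.

Set Implicit Arguments.
Unset Strict Implicit.
Unset Printing Implicit Defensive.

Import Order.TTheory GRing.Theory Num.Theory.
Local Open Scope ring_scope.
Local Open Scope sesquilinear_scope.

Local Notation "x %:F" := (FracField.tofrac x) : ring_scope.

(* A rational matrix function is a matrix over the field C(z), represented by
   {fraction {poly C}}.  In particular invmx and \det of such matrices are
   taken in C(z), and "\det F is not identically 0" is \det F != 0. *)

Section RationalMatrixFunctions.

Variable C : numClosedFieldType.

(* f has no pole at z, and takes the value v there *)
Definition ratfun_val (f : {fraction {poly C}}) (z v : C) : Prop :=
  exists p q : {poly C},
    [/\ q.[z] != 0, f = p%:F / q%:F & v = p.[z] / q.[z]].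

(* no entry of F has a pole at z, and F(z) = V *)
Definition ratmx_val m (F : 'M[{fraction {poly C}}]_m) (z : C) (V : 'M[C]_m)
  : Prop := forall i j, ratfun_val (F i j) z (V i j).

Definition Re_mx m (K : 'M[C]_m) : 'M[C]_m := 2%:R^-1 *: (K + K ^t*).

Definition hermitian_psd m (K : 'M[C]_m) : Prop :=
  K ^t* = K /\ forall v : 'cV[C]_m, 0 <= (v ^t* *m K *m v) 0 0.

(* positive real odd functions; the first clause includes that F has no pole in
   the open right half-plane *)
Definition PRO m (F : 'M[{fraction {poly C}}]_m) : Prop :=
  [/\ forall z, 0 < 'Re z ->
        exists2 V, ratmx_val F z V & hermitian_psd (Re_mx V),
      forall t V, t \is Num.real -> ratmx_val F t V -> V \is a mxOver Num.real
    & forall z V, ratmx_val F z V ->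
        exists2 W, ratmx_val F (- z^*) W & - V = W ^t*].

End RationalMatrixFunctions.

Section Realizations.

Variables (R : rcfType) (m n : nat).

Definition ratmx p q (K : 'M[R]_(p, q)) : 'M[{fraction {poly R[i]}}]_(p, q) :=
  map_mx (fun x => (real_complex R x)%:P%:F) K.

(* z M + D + B^T (z I - A)^-1 B; note that z I - A is always invertible over
   C(z), so invmx is a genuine inverse here *)
Definition realization (M D : 'M[R]_m) (A : 'M[R]_n) (B : 'M[R]_(n, m))
  : 'M[{fraction {poly R[i]}}]_m :=
  let z := 'X%:F in
  z *: ratmx M + ratmx D + ratmx B^T *m invmx (z%:M - ratmx A) *m ratmx B.

Definition controllable (A : 'M[R]_n) (B : 'M[R]_(n, m)) : Prop :=
  \rank (\mxrow_(j < n) (A ^+ j *m B)) = n.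

Definition psd (K : 'M[R]_m) : Prop :=
  K^T = K /\ forall v : 'cV[R]_m, 0 <= (v^T *m K *m v) 0 0.

(* S = K^(1/2) *)
Definition psd_sqrt (K S : 'M[R]_m) : Prop := psd S /\ S *m S = K.

End Realizations.

(* Matrices act on column vectors.  A subspace of R^m is given, as usual in
   mxalgebra, by a matrix whose rows span it; hence the transpositions. *)

Section Decomposition.

Variables (R : rcfType) (m : nat).
Implicit Types M D U : 'M[R]_m.

(* { v | M v = 0 } *)
Definition null_space M : 'M[R]_m := kermx M^T.

Definition orth_compl U : 'M[R]_m := kermx U^T.

(* orthogonal projection onto U, acting on column vectors *)
Definition orth_proj U : 'M[R]_m := (proj_mx U (orth_compl U))^T.

(* X_1 = (ker M)^\perp, X_3 = ker (P_(ker M) D |_(ker M)), and X_2 the orthogonal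
   complement of X_3 in ker M *)
Definition space1 M := orth_compl (null_space M).

Definition space3 M D :=
  (null_space M :&: null_space (orth_proj (null_space M) *m D))%MS.

Definition space2 M D := (null_space M :&: orth_compl (space3 M D))%MS.

(* the columns of E form an orthonormal basis of U *)
Definition orthonormal_basis d (E : 'M[R]_(m, d)) U : Prop :=
  E^T *m E = 1%:M /\ (E^T :=: U)%MS.

End Decomposition.

Section Inverse.

Variables (R : rcfType) (n m m1 m2 m3 k : nat).
Variables (M D : 'M[R]_m) (A : 'M[R]_n) (B : 'M[R]_(n, m)).

(* E1, E2, E3 : orthonormal bases of X_1, X_2, X_3.  Maps defined on, or with
   values in, some X_i are represented by their matrices in these bases; since
   the bases are orthonormal, transposes of maps correspond to transposes of
   matrices. *)
Variables (E1 : 'M[R]_(m, m1)) (E2 : 'M[R]_(m, m2)) (E3 : 'M[R]_(m, m3)).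
Variables (K1 : 'M[R]_m1) (Xi : 'M[R]_m3) (Gamma : 'M[R]_(n + m1, k)).

Variable sqrtPhi33 : 'M[R]_m3.

Definition block_M1 : 'M[R]_m1 := E1^T *m M *m E1.

Local Notation M1 := block_M1.
Local Notation B1 := (B *m E1).
Local Notation B2 := (B *m E2).
Local Notation B3 := (B *m E3).
Local Notation D11 := (E1^T *m D *m E1).
Local Notation D12 := (E1^T *m D *m E2).
Local Notation D13 := (E1^T *m D *m E3).
Local Notation D22 := (E2^T *m D *m E2).
Local Notation iM1 := (invmx M1).
Local Notation iD22 := (invmx D22).
Local Notation iK1 := (invmx K1).
Local Notation iK1T := (invmx K1)^T.
Local Notation E123 := (row_mx E1 (row_mx E2 E3)).

Local Notation mx3x3 a11 a12 a13 a21 a22 a23 a31 a32 a33 :=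
  (col_mx (row_mx a11 (row_mx a12 a13))
  (col_mx (row_mx a21 (row_mx a22 a23))
          (row_mx a31 (row_mx a32 a33)))).

Definition A_tilde : 'M[R]_(n + m1) :=
  block_mx
    (A - B2 *m iD22 *m B2^T)
    ((B1 + B2 *m iD22 *m D12^T) *m iK1)
    (iK1T *m (- B1^T + D12 *m iD22 *m B2^T))
    (- (iK1T *m (D11 + D12 *m iD22 *m D12^T) *m iK1)).

Definition B_tilde : 'M[R]_(n + m1, m3) :=
  col_mx (B3 *m Xi^T) (- (iK1T *m D13 *m Xi^T)).

Definition Phi33 : 'M[R]_m3 := B3^T *m B3 + D13^T *m iM1 *m D13.

Definition Phi23 : 'M[R]_(m2, m3) := B2^T *m B3 + D12^T *m iM1 *m D13.

Local Notation iPhi33 := (invmx Phi33).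

Definition A_inv : 'M[R]_k := Gamma^T *m A_tilde *m Gamma.

Definition B_inv : 'M[R]_(k, m) :=
  Gamma^T *m
  col_mx
    (row_mx 0 (row_mx (B2 *m iD22)
      ((A *m B3 - B1 *m iM1 *m D13 - B2 *m iD22 *m Phi23) *m iPhi33)))
    (row_mx iK1T (row_mx (- (iK1T *m D12 *m iD22))
      (- (iK1T *m (B1^T *m B3 - D11 *m iM1 *m D13 - D12 *m iD22 *m Phi23)
          *m iPhi33))))
  *m E123^T.

Definition K_inv : 'M[R]_(m3, m) :=
  row_mx 0 (row_mx 0 (- (Xi *m invmx sqrtPhi33))) *m E123^T.

Definition M_inv : 'M[R]_m := K_inv^T *m K_inv.

Definition D_inv : 'M[R]_m :=
  E123 *m
  mx3x3
    0                             0
      (- (iM1 *m D13 *m iPhi33))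
    0                             iD22
      (- (iD22 *m Phi23 *m iPhi33))
    (iPhi33 *m D13^T *m iM1)      (- (iPhi33 *m Phi23^T *m iD22))
      (- (iPhi33 *m Xi^T *m B_tilde^T *m A_tilde *m B_tilde *m Xi *m iPhi33))
  *m E123^T.

End Inverse.

(* Main.v *)
Require Import Defs.
From mathcomp Require Import all_boot all_order all_algebra.
From mathcomp Require Import complex reals.
From mathcomp Require Import ring.

Set Implicit Arguments.
Unset Strict Implicit.
Unset Printing Implicit Defensive.

Import Order.TTheory GRing.Theory Num.Theory.
Local Open Scope ring_scope.

(** The theorem is a change of state-space description.  Write the equation
    F(z) u = y with the state x = (z - A)^-1 B u and the coordinates u_i, y_i of
    u and y in X_1, X_2, X_3.  The X_2-equation contains no z, and D_22 is
    invertible, so it can be solved for u_2; the X_1-equation becomes a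
    differential equation for w = K_1 u_1, since M_1 = K_1^T K_1.  With
    xi = (x, w), what remains is the descriptor system

      z xi = At xi + H u_3 + J y,      H^T xi = y_3,

    where At is the skew-symmetric matrix A_tilde of the statement and
    H = B_tilde Xi is both the input map of u_3 and, transposed, the map of the
    constraint coming from X_3.

    A vector v with H v = 0 yields a constant vector E_3 v killed by F(z) for
    all z; hence det F <> 0 makes the Gram matrix Phi_33 = H^T H invertible
    ([unitmx_Phi33]), and Gamma Gamma^T + H Phi_33^-1 H^T = 1
    ([tall_split_id]).  Thus the constraint says exactly that
    xi = Gamma eta + H Phi_33^-1 y_3.  Applying Gamma^T to the state equation
    leaves an ordinary system for eta, with state matrix A_inv; applying H^T
    determines u_3, and the term z y_3 it contains produces M_inv
    ([zero_dynamics]).  Reading off u from eta and y gives the claimed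
    realization G, and running the computation backwards shows that every column
    of G solves F u = y for a basis vector y, so F G = 1
    ([realization_mul_inverse]).  Skew-symmetry of At is what makes the output
    map of G the transpose of its input map B_inv.

    For controllability, let v A_inv^j B_inv = 0 for all j.  The three block
    columns of B_inv force the row vectors r_j = v A_inv^j Gamma^T to have the
    form (x_j, 0), with x_j B_2 = x_j B_3 = 0 and r_j At H = 0.  The last
    equation gives r_(j+1) = r_j At, whose blocks read x_(j+1) = x_j A and
    x_j B_1 = 0.  So x_0 A^j B = 0 for all j, and controllability of (A, B)
    yields x_0 = 0, hence v = 0 ([controllable_inverse]). *)

(** * Matrices with trivial left kernel *)

Lemma row_mulmx_inj (F : fieldType) m n p (X : 'M[F]_(m, n))
    (Y : 'M[F]_(n, p)) :
  (forall v : 'rV_n, v *m Y = 0 -> v = 0) -> X *m Y = 0 -> X = 0.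
Proof.
move=> inj XY0; apply/row_matrixP => i; rewrite row0.
by apply: inj; rewrite -row_mul XY0 row0.
Qed.

Lemma unitmx_row_inj (F : fieldType) n (Y : 'M[F]_n) :
  (forall v : 'rV_n, v *m Y = 0 -> v = 0) -> Y \in unitmx.
Proof.
move=> inj; rewrite -row_free_unit -kermx_eq0; apply/eqP.
by apply: row_mulmx_inj inj (mulmx_ker Y).
Qed.

(** * Orthogonal complements over a real closed field *)

Section RealMatrices.

Variable R : rcfType.

(** The diagonal of [X *m X^T] consists of sums of squares. *)
Lemma mulmx_trmx_eq0 m n (X : 'M[R]_(m, n)) : X *m X^T = 0 -> X = 0.
Proof.
move=> XX0; apply/matrixP => i j; rewrite [RHS]mxE.
have : (X *m X^T) i i = 0 by rewrite XX0 mxE.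
rewrite mxE => /psumr_eq0P s0.
have /eqP : X i j * X^T j i = 0.
  by apply: s0 => // l _; rewrite mxE -expr2 sqr_ge0.
by rewrite mxE -expr2 sqrf_eq0 => /eqP.
Qed.

Lemma orth_complP m p (U : 'M[R]_m) (X : 'M[R]_(p, m)) :
  reflect (X *m U^T = 0) (X <= orth_compl U)%MS.
Proof. exact: sub_kermxP. Qed.

Lemma null_spaceP m p (M : 'M[R]_m) (X : 'M[R]_(p, m)) :
  reflect (X *m M^T = 0) (X <= null_space M)%MS.
Proof. exact: sub_kermxP. Qed.

Lemma capmx_orth_compl m (U : 'M[R]_m) : (U :&: orth_compl U)%MS = 0.
Proof.
apply/eqP; rewrite -submx0; set W := (_ :&: _)%MS.
have /orth_complP WU0 : (W <= orth_compl U)%MS := capmxSr _ _.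
have /submxP [C WC] : (W <= U)%MS := capmxSl _ _.
by rewrite [W]mulmx_trmx_eq0 ?sub0mx // [in W^T]WC trmx_mul mulmxA WU0 mul0mx.
Qed.

Lemma addsmx_orth_compl m (U : 'M[R]_m) : (1%:M <= U + orth_compl U)%MS.
Proof.
rewrite sub1mx; apply/eqP; have := mxrank_sum_cap U (orth_compl U).
rewrite capmx_orth_compl mxrank0 addn0 => ->.
by rewrite mxrank_ker mxrank_tr subnKC ?rank_leq_col.
Qed.

Lemma mul_proj_mx_orth_eq0 m p (U : 'M[R]_m) (X : 'M[R]_(p, m)) :
  reflect (X *m U^T = 0) (X *m proj_mx U (orth_compl U) == 0).
Proof.
apply: (iffP eqP) => [X0|XU].
  apply/orth_complP; rewrite -[X]subr0 -X0; apply: proj_mx_compl_sub.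
  by apply: submx_trans (submx1 _) (addsmx_orth_compl U).
by apply: proj_mx_0 (capmx_orth_compl U) _; apply/orth_complP.
Qed.

End RealMatrices.

(** * Controllability as unobservability of row vectors *)

Lemma horner_mxE (F : comNzRingType) n (A : 'M[F]_n.+1) (p : {poly F}) :
  horner_mx A p = \sum_(i < size p) p`_i *: A ^+ i.
Proof.
rewrite -[p in LHS]coefK poly_def linear_sum; apply: eq_bigr => i _.
by rewrite linearZ /= rmorphXn /= horner_mx_X.
Qed.

(** By Cayley-Hamilton every power of [A] is a combination of the first [n]
    ones, so the Kalman rank condition may be tested with all powers.  This
    removes the bound on [j], which would otherwise obstruct the comparison of
    systems of different state dimensions. *)
Lemma controllableP (R : rcfType) n m (A : 'M[R]_n) (B : 'M[R]_(n, m)) :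
  controllable A B <->
  (forall v : 'rV_n, (forall j, v *m (A ^+ j *m B) = 0) -> v = 0).
Proof.
rewrite /controllable; split=> [rk v vAB|inj]; last first.
  apply/eqP; rewrite -/(row_free _) -kermx_eq0; apply/eqP.
  case: n A B inj => [|n] A B inj; first by apply/matrixP => -[].
  apply: row_mulmx_inj (mulmx_ker _) => v.
  rewrite mul_mxrow -mxrow0 => /eq_mxrowP v0.
  apply: inj => j; rewrite -(horner_mx_X A) -rmorphXn /=.
  rewrite (divp_eq 'X^j (char_poly A)) rmorphD rmorphM /= Cayley_Hamilton.
  rewrite mulr0 add0r horner_mxE mulmx_suml mulmx_sumr big1 // => i _.
  have lt_i : (i < n.+1)%N.
    rewrite (leq_trans (ltn_ord i)) // -ltnS -(size_char_poly A) ltn_modp.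
    by rewrite monic_neq0 ?char_poly_monic.
  by rewrite -scalemxAl -scalemxAr (v0 (Ordinal lt_i)) scaler0.
apply/eqP; rewrite -submx0.
move/eqP: rk; rewrite -/(row_free _) -kermx_eq0 => /eqP <-.
by apply/sub_kermxP; rewrite mul_mxrow -mxrow0; apply: eq_mxrow => j.
Qed.

(** * Block structure of M and D in the decomposition X_1 + X_2 + X_3 *)

Section Decomposition.

Variables (R : rcfType) (m m1 m2 m3 : nat) (M D : 'M[R]_m).
Variables (E1 : 'M[R]_(m, m1)) (E2 : 'M[R]_(m, m2)) (E3 : 'M[R]_(m, m3)).
Hypotheses (symM : M^T = M) (skewD : D^T = - D).
Hypotheses (onE1 : orthonormal_basis E1 (space1 M))
  (onE2 : orthonormal_basis E2 (space2 M D))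
  (onE3 : orthonormal_basis E3 (space3 M D)).

Let N := null_space M.

Let E2_N : (E2^T <= N)%MS.
Proof. by rewrite onE2.2 capmxSl. Qed.

Let E3_N : (E3^T <= N)%MS.
Proof. by rewrite onE3.2 capmxSl. Qed.

Let N_E1 : N *m E1 = 0.
Proof.
have: (E1^T <= orth_compl N)%MS by rewrite onE1.2.
by move/orth_complP/(congr1 trmx); rewrite trmx_mul !trmxK trmx0.
Qed.

Lemma mulmx_M_E2 : M *m E2 = 0.
Proof.
by move/null_spaceP: E2_N => /(congr1 trmx); rewrite trmx_mul !trmxK trmx0.
Qed.

Lemma mulmx_M_E3 : M *m E3 = 0.
Proof.
by move/null_spaceP: E3_N => /(congr1 trmx); rewrite trmx_mul !trmxK trmx0.
Qed.

Lemma mulmx_E2T_E1 : E2^T *m E1 = 0.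
Proof. by have /submxP [C ->] := E2_N; rewrite -mulmxA N_E1 mulmx0. Qed.

Lemma mulmx_E3T_E1 : E3^T *m E1 = 0.
Proof. by have /submxP [C ->] := E3_N; rewrite -mulmxA N_E1 mulmx0. Qed.

Let S3_E2 : space3 M D *m E2 = 0.
Proof.
have: (E2^T <= orth_compl (space3 M D))%MS by rewrite onE2.2 capmxSr.
by move/orth_complP/(congr1 trmx); rewrite trmx_mul !trmxK trmx0.
Qed.

Lemma mulmx_E3T_E2 : E3^T *m E2 = 0.
Proof.
have /submxP [C ->] : (E3^T <= space3 M D)%MS by rewrite onE3.2.
by rewrite -mulmxA S3_E2 mulmx0.
Qed.

(* ker M is the double orthogonal complement of itself because the rows of the
   symmetric matrix M already lie in X_1. *)
Let space1_E1 p (X : 'M_(p, m)) : X *m E1 = 0 -> (X <= N)%MS.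
Proof.
move=> XE1; apply/null_spaceP.
have /submxP [C ->] : (M <= E1^T)%MS.
  rewrite onE1.2; apply/orth_complP; rewrite -[LHS]trmxK trmx_mul trmxK.
  by rewrite symM -[M in _ *m M]symM (mulmx_ker M^T) trmx0.
by rewrite trmx_mul trmxK mulmxA XE1 mul0mx.
Qed.

(** The three bases together form an orthonormal basis.  Since they are
    orthonormal, it suffices that a vector [v] orthogonal to all of them vanishes:
    orthogonality to X_1 puts [v] in ker M, orthogonality to X_3 then puts it in
    X_2, to which it is orthogonal too. *)
Lemma decomposition_id : E1 *m E1^T + E2 *m E2^T + E3 *m E3^T = 1%:M.
Proof.
have inj (v : 'rV_m) : v *m row_mx E1 (row_mx E2 E3) = 0 -> v = 0.
  rewrite !mul_mx_row => /eqP.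
  rewrite !row_mx_eq0 => /and3P[/eqP v1 /eqP v2 /eqP v3].
  have /submxP [C vC] : (v <= E2^T)%MS.
    rewrite onE2.2 sub_capmx space1_E1 //=; apply/orth_complP.
    have /submxP [C ->] : (space3 M D <= E3^T)%MS by rewrite onE3.2.
    by rewrite trmx_mul trmxK mulmxA v3 mul0mx.
  by move: v2; rewrite {1}vC -mulmxA onE2.1 mulmx1 vC => ->; rewrite mul0mx.
have E12 : E1^T *m E2 = 0.
  by rewrite -[LHS]trmxK trmx_mul trmxK mulmx_E2T_E1 trmx0.
have E13 : E1^T *m E3 = 0.
  by rewrite -[LHS]trmxK trmx_mul trmxK mulmx_E3T_E1 trmx0.
have E23 : E2^T *m E3 = 0.
  by rewrite -[LHS]trmxK trmx_mul trmxK mulmx_E3T_E2 trmx0.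
apply/eqP; rewrite -subr_eq0; apply/eqP; apply: row_mulmx_inj inj _.
rewrite !mul_mx_row !mulmxBl !mulmxDl -!mulmxA mul1mx.
rewrite onE1.1 onE2.1 onE3.1 mulmx_E2T_E1 mulmx_E3T_E1 mulmx_E3T_E2 E12 E13 E23.
by rewrite !mulmx1 !mulmx0 ?mul1mx ?addr0 ?add0r !subrr !row_mx0.
Qed.

(* In ker M, lying in ker (P D) means that D maps the vector into (ker M)^\perp.
   Skew-symmetry allows testing this on row vectors with D in place of D^T. *)
Let D_space3 p (X : 'M_(p, m)) :
  (X <= N)%MS -> reflect (X *m D *m N^T = 0) (X <= space3 M D)%MS.
Proof.
move=> XN; rewrite sub_capmx XN /=; apply: (iffP idP) => [/null_spaceP|X0].
  rewrite trmx_mul trmxK mulmxA => /eqP /mul_proj_mx_orth_eq0.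
  by rewrite skewD mulmxN mulNmx => /eqP; rewrite oppr_eq0 => /eqP.
apply/null_spaceP; rewrite trmx_mul trmxK mulmxA; apply/eqP/mul_proj_mx_orth_eq0.
by rewrite skewD mulmxN mulNmx X0 oppr0.
Qed.

Let E3_D_N : E3^T *m D *m N^T = 0.
Proof. by apply/D_space3; rewrite // onE3.2. Qed.

Lemma mulmx_E3T_D_E3 : E3^T *m D *m E3 = 0.
Proof.
have /submxP [C /(congr1 trmx)] := E3_N; rewrite trmx_mul trmxK => E3C.
by rewrite {2}E3C mulmxA E3_D_N mul0mx.
Qed.

Lemma mulmx_E3T_D_E2 : E3^T *m D *m E2 = 0.
Proof.
have /submxP [C /(congr1 trmx)] := E2_N; rewrite trmx_mul trmxK => ->.
by rewrite mulmxA E3_D_N mul0mx.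
Qed.

Lemma mulmx_E2T_D_E3 : E2^T *m D *m E3 = 0.
Proof.
apply: trmx_inj; rewrite !trmx_mul trmxK skewD mulNmx mulmxN mulmxA.
by rewrite mulmx_E3T_D_E2 oppr0 trmx0.
Qed.

(** A vector of X_2 killed by D_22 is mapped by D to a vector orthogonal to both
    X_2 and X_3, that is to ker M; so it belongs to X_3 as well, and vanishes. *)
Lemma unitmx_D22 : E2^T *m D *m E2 \in unitmx.
Proof.
apply: unitmx_row_inj => v; rewrite !mulmxA => v0.
have vN : (v *m E2^T <= N)%MS := submx_trans (submxMl _ _) E2_N.
have /submxP [C vC] : (v *m E2^T <= space3 M D)%MS.
  apply/D_space3 => //; rewrite -[N^T]mul1mx -decomposition_id !mulmxDl !mulmxDr.
  have -> : E1 *m E1^T *m N^T = 0 by rewrite -mulmxA -trmx_mul N_E1 trmx0 mulmx0.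
  rewrite mulmx0 add0r !mulmxA v0 !mul0mx add0r.
  rewrite -[v *m _ *m D]mulmxA -[v *m _ *m E3]mulmxA mulmx_E2T_D_E3.
  by rewrite mulmx0 !mul0mx.
by rewrite -[v]mulmx1 -onE2.1 mulmxA vC -mulmxA S3_E2 mulmx0.
Qed.

(** A vector of X_1 killed by M_1 lies in ker M, which is orthogonal to X_1. *)
Lemma unitmx_M1 : block_M1 M E1 \in unitmx.
Proof.
apply: unitmx_row_inj => v; rewrite /block_M1 !mulmxA => v0.
have /submxP [C vC] : (v *m E1^T <= N)%MS.
  apply/null_spaceP; rewrite symM -[LHS]mulmx1 -decomposition_id.
  rewrite !mulmxDr !mulmxA v0 -![_ *m M *m _]mulmxA mulmx_M_E2 mulmx_M_E3.
  by rewrite !mulmx0 !mul0mx !addr0.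
by rewrite -[v]mulmx1 -onE1.1 mulmxA vC -mulmxA N_E1 mulmx0.
Qed.

End Decomposition.

(** * Solving F u = y through a state vector *)

Section BlockSolution.

Variables (K : fieldType) (z : K) (n m m1 m2 m3 : nat).
Variables (M D : 'M[K]_m) (A : 'M[K]_n) (B : 'M[K]_(n, m)).
Variables (E1 : 'M[K]_(m, m1)) (E2 : 'M[K]_(m, m2)) (E3 : 'M[K]_(m, m3)).
Hypothesis E_id : E1 *m E1^T + E2 *m E2^T + E3 *m E3^T = 1%:M.
Hypotheses (ME2 : M *m E2 = 0) (ME3 : M *m E3 = 0).
Hypotheses (E2M : E2^T *m M = 0) (E3M : E3^T *m M = 0).
Hypotheses (D23 : E2^T *m D *m E3 = 0) (D32 : E3^T *m D *m E2 = 0)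
  (D33 : E3^T *m D *m E3 = 0).
Hypothesis zA_unit : z%:M - A \in unitmx.

(** [x] is the state (z - A)^-1 B u; the last three hypotheses are the equation
    F u = y in the coordinates of X_1, X_2, X_3, cleared of the blocks of M and
    of the blocks D_23, D_32, D_33, which vanish. *)
Lemma mul_realization_eq p (x : 'M_(n, p)) u1 u2 u3 (y : 'M_(m, p)) :
  let u := E1 *m u1 + E2 *m u2 + E3 *m u3 in
  z *: x = A *m x + B *m u ->
  z *: (E1^T *m M *m E1 *m u1) + E1^T *m D *m u + (B *m E1)^T *m x
    = E1^T *m y ->
  E2^T *m D *m (E1 *m u1 + E2 *m u2) + (B *m E2)^T *m x = E2^T *m y ->
  E3^T *m D *m E1 *m u1 + (B *m E3)^T *m x = E3^T *m y ->
  (z *: M + D + B^T *m invmx (z%:M - A) *m B) *m u = y.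
Proof.
move=> u st o1 o2 o3.
have Bu : invmx (z%:M - A) *m (B *m u) = x.
  by rewrite -[x](mulKmx zA_unit) mulmxBl mul_scalar_mx st addrAC subrr add0r.
rewrite !mulmxDl -!mulmxA Bu -[RHS]mul1mx -[LHS]mul1mx -E_id !mulmxDl -!mulmxA.
congr (_ + _ + _); congr (_ *m _).
- rewrite -o1 /u !mulmxDr trmx_mul !mulmxA; congr (_ + _ + _).
  rewrite -!scalemxAr -!scalemxAl -![E1^T *m M *m _]mulmxA ME2 ME3.
  by rewrite !mulmx0 !mul0mx !scaler0 !addr0.
- rewrite -o2 /u !mulmxDr trmx_mul !mulmxA -!scalemxAr -!scalemxAl E2M.
  by rewrite !mul0mx !scaler0 !add0r D23 mul0mx addr0.
- rewrite -o3 /u !mulmxDr trmx_mul !mulmxA -!scalemxAr -!scalemxAl E3M.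
  by rewrite !mul0mx !scaler0 !add0r D32 D33 !mul0mx !addr0.
Qed.

End BlockSolution.

(** * Elimination of the constraint *)

Section ZeroDynamics.

(** [row_mx G H] is square and the left-hand side is this matrix times its left
    inverse, in the order that is not obvious. *)
Lemma tall_split_id (K : fieldType) N k p (G : 'M[K]_(N, k))
    (H : 'M[K]_(N, p)) :
  N = (k + p)%N -> G^T *m G = 1%:M -> G^T *m H = 0 -> H^T *m H \in unitmx ->
  G *m G^T + H *m invmx (H^T *m H) *m H^T = 1%:M.
Proof.
move=> eqN; subst N => GG GH HH.
have HG : H^T *m G = 0 by rewrite -[LHS]trmxK trmx_mul trmxK GH trmx0.
have : col_mx G^T (invmx (H^T *m H) *m H^T) *m row_mx G H = 1%:M.
  by rewrite mul_col_row GG GH -!mulmxA HG mulmx0 mulVmx // -scalar_mx_block.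
by move/mulmx1C; rewrite mul_row_col mulmxA.
Qed.

(** The vector multiplied by [H] on the right is the input that keeps a state
    [xi] on the constraint H^T xi = y, for [P] the inverse of H^T H and the
    columns of [G] orthogonal to those of [H].  The hypothesis on [eta] is the
    G-component of the state equation, and the input is chosen so that its
    H-component holds. *)
Lemma zero_dynamics (K : fieldType) (z : K) N k p q (At : 'M[K]_N)
    (G : 'M[K]_(N, k)) (H : 'M[K]_(N, p)) (P : 'M[K]_p)
    (J : 'M[K]_(N, q)) (y : 'M[K]_(p, q)) (eta : 'M[K]_(k, q)) :
  G *m G^T + H *m P *m H^T = 1%:M ->
  z *: eta = G^T *m At *m G *m eta + G^T *m (J + At *m H *m P *m y) ->
  let xi := G *m eta + H *m P *m y in
  z *: xi = At *m xi + H *m (P *m (z *: y - H^T *m (At *m xi + J))) + J.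
Proof.
move=> GH ez xi.
have -> : z *: xi = G *m (G^T *m (At *m xi + J)) + z *: (H *m P *m y).
  rewrite scalerDr scalemxAr ez; congr (_ + _); congr (_ *m _).
  by rewrite /xi !mulmxDr !mulmxA -addrA [_ + G^T *m J]addrC.
rewrite [RHS]addrAC; set V := At *m xi + J.
have VE : V = G *m (G^T *m V) + H *m (P *m (H^T *m V)).
  by rewrite !mulmxA -mulmxDl GH mul1mx.
rewrite [X in _ = X + _]VE !mulmxBr -!scalemxAr -[H *m P *m y]mulmxA.
by rewrite addrCA addrK addrC.
Qed.

End ZeroDynamics.

(** * Identities between sums of matrix products *)

Section AbelianNormalization.

Variables (K : pzRingType) (m n : nat).
Implicit Types X Y : 'M[K]_(m, n).

Lemma addmxE X Y i j : (X + Y) i j = X i j + Y i j. Proof. exact: mxE. Qed.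
Lemma oppmxE X i j : (- X) i j = - X i j. Proof. exact: mxE. Qed.
Lemma zeromxE i j : (0 : 'M[K]_(m, n)) i j = 0. Proof. exact: mxE. Qed.

End AbelianNormalization.

(* Identities between sums of products of rectangular matrices: after full
   distribution, each entry is a linear identity whose atoms are the entries of
   the products. *)
Ltac mx_expand :=
  rewrite ?(mulmxDl, mulmxDr, mulmxN, mulNmx, mul0mx, mulmx0, mulmxA).
Ltac mx_abel :=
  apply/matrixP => ? ?; rewrite ?(addmxE, oppmxE, zeromxE); ring.

(** * The descriptor system and the data of the inverse *)

Section InverseData.

Variables (R : rcfType) (n m m1 m2 m3 : nat).
Variables (M D : 'M[R]_m) (A : 'M[R]_n) (B : 'M[R]_(n, m)).
Variables (E1 : 'M[R]_(m, m1)) (E2 : 'M[R]_(m, m2)) (E3 : 'M[R]_(m, m3)).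
Variables (K1 : 'M[R]_m1) (Xi : 'M[R]_m3).

Hypotheses (symM : M^T = M) (skewA : A^T = - A) (skewD : D^T = - D).
Hypotheses (onE1 : orthonormal_basis E1 (space1 M))
  (onE2 : orthonormal_basis E2 (space2 M D))
  (onE3 : orthonormal_basis E3 (space3 M D)).
Hypotheses (K1_M1 : K1^T *m K1 = block_M1 M E1) (Xi_orth : Xi^T *m Xi = 1%:M).

Local Notation M1 := (block_M1 M E1).
Local Notation B1 := (B *m E1).
Local Notation B2 := (B *m E2).
Local Notation B3 := (B *m E3).
Local Notation D11 := (E1^T *m D *m E1).
Local Notation D12 := (E1^T *m D *m E2).
Local Notation D13 := (E1^T *m D *m E3).
Local Notation D22 := (E2^T *m D *m E2).
Local Notation iM1 := (invmx M1).
Local Notation iD22 := (invmx D22).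
Local Notation iK1 := (invmx K1).
Local Notation iK1T := (invmx K1)^T.
Local Notation At := (A_tilde D A B E1 E2 K1).
Local Notation Phi := (Phi33 M D B E1 E3).
Local Notation iPhi := (invmx Phi).
Local Notation Psi := (Phi23 M D B E1 E2 E3).

(** The coefficient of u_3 in the state equation for xi = (x, K_1 u_1).  It is
    [B_tilde] freed of the auxiliary isometry [Xi]; see [B_tilde_Xi]. *)
Definition constraint_input : 'M[R]_(n + m1, m3) :=
  col_mx B3 (- (iK1T *m D13)).
(** The coefficient of y in the state equation for xi = (x, K_1 u_1), after
    elimination of u_2. *)
Definition driven_input : 'M[R]_(n + m1, m) :=
  col_mx (B2 *m iD22 *m E2^T) (iK1T *m (E1^T - D12 *m iD22 *m E2^T)).

Local Notation H := constraint_input.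
Local Notation J := driven_input.

(** The coefficient of y in the state equation when the part H Phi_33^-1 y_3 of
    xi, which the constraint prescribes, is moved to the input. *)
Definition full_input : 'M[R]_(n + m1, m) := J + At *m H *m iPhi *m E3^T.
Local Notation L := full_input.

Let uD22 : D22 \in unitmx. Proof. exact: unitmx_D22 onE1 onE2 onE3. Qed.
Let uM1 : M1 \in unitmx. Proof. exact: unitmx_M1 onE1 onE2 onE3. Qed.

Lemma unitmx_K1 : K1 \in unitmx.
Proof. by move: uM1; rewrite -K1_M1 unitmx_mul => /andP[]. Qed.

Lemma invmx_M1 : iM1 = iK1 *m iK1T.
Proof.
have M1K : M1 *m (iK1 *m iK1T) = 1%:M.
  rewrite -K1_M1 mulmxA (mulmxK unitmx_K1) -trmx_mul.
  by rewrite mulVmx ?unitmx_K1 // trmx1.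
by rewrite -[RHS](mulKmx uM1) M1K mulmx1.
Qed.

Lemma tr_invmx_D22 : iD22^T = - iD22.
Proof.
have D22T : D22^T = -1 *: D22.
  by rewrite scaleN1r !trmx_mul trmxK skewD mulNmx mulmxN mulmxA.
by rewrite trmx_inv D22T invmxZ -?D22T ?unitmx_tr // invrN1 scaleN1r.
Qed.

Lemma B_tilde_Xi : B_tilde D B E1 E3 K1 Xi *m Xi = H.
Proof. by rewrite mul_col_mx mulNmx -![_ *m Xi^T *m Xi]mulmxA Xi_orth !mulmx1. Qed.

Lemma Phi33_gram : H^T *m H = Phi.
Proof.
rewrite tr_col_mx mul_row_col [(- _)^T]linearN /= mulNmx mulmxN opprK /Phi33.
by rewrite invmx_M1 !trmx_mul !trmxK !mulmxA.
Qed.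

Lemma A_tilde_skew : At^T = - At.
Proof.
rewrite tr_block_mx opp_block_mx; congr block_mx.
- rewrite linearB /= !trmx_mul !trmxK skewA tr_invmx_D22; mx_expand.
  by mx_abel.
- rewrite !trmx_mul linearD linearN /= !trmx_mul !trmxK tr_invmx_D22.
  by mx_expand; mx_abel.
- rewrite !trmx_mul linearD /= !trmx_mul !trmxK tr_invmx_D22; mx_expand.
  by mx_abel.
- rewrite linearN /= !trmx_mul !trmxK linearD /= !trmx_mul !trmxK.
  by rewrite tr_invmx_D22 skewD; mx_expand; mx_abel.
Qed.

Lemma A_tilde_H : At *m H =
  col_mx (A *m B3 - B1 *m iM1 *m D13 - B2 *m iD22 *m Psi)
    (- (iK1T *m (B1^T *m B3 - D11 *m iM1 *m D13 - D12 *m iD22 *m Psi))).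
Proof.
rewrite mul_block_col /Phi23 invmx_M1.
by congr col_mx; mx_expand; mx_abel.
Qed.

(** If v^T is in the kernel of Phi_33 = H^T H, it is in the kernel of H.  Then
    B, M and D all kill E_3 v^T, hence so does F, which is invertible. *)
Lemma unitmx_Phi33 (K : fieldType) (f : {rmorphism R -> K}) (z : K) :
  z *: map_mx f M + map_mx f D
    + (map_mx f B)^T *m invmx (z%:M - map_mx f A) *m map_mx f B \in unitmx ->
  Phi \in unitmx.
Proof.
move=> uF; apply: unitmx_row_inj => v; rewrite -Phi33_gram => vHH.
have /(congr1 trmx) : v *m H^T = 0.
  apply: mulmx_trmx_eq0; rewrite trmx_mul trmxK -mulmxA (mulmxA _ H) mulmxA.
  by rewrite vHH mul0mx.
rewrite trmx_mul trmxK trmx0 mul_col_mx => /eqP.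
rewrite col_mx_eq0 mulNmx oppr_eq0 -(mulmxA iK1T) => /andP[/eqP B3v /eqP].
move/(congr1 (mulmx K1^T)); rewrite mulmx0 (mulmxA K1^T) -trmx_mul.
rewrite mulVmx ?unitmx_K1 // trmx1 mul1mx -!mulmxA => D13v.
have Dv : D *m (E3 *m v^T) = 0.
  rewrite -[LHS]mul1mx -(decomposition_id symM onE1 onE2 onE3) !mulmxDl -!mulmxA.
  have D23 := mulmx_E2T_D_E3 skewD onE2 onE3.
  have D33 := mulmx_E3T_D_E3 skewD onE3.
  rewrite D13v (mulmxA D) (mulmxA E2^T) (mulmxA E2^T) D23.
  by rewrite (mulmxA E3^T) (mulmxA E3^T) D33 !mul0mx !mulmx0 !addr0.
have Fv : (z *: map_mx f M + map_mx f D
    + (map_mx f B)^T *m invmx (z%:M - map_mx f A) *m map_mx f B)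
    *m map_mx f (E3 *m v^T) = 0.
  rewrite !mulmxDl -scalemxAl -(mulmxA _ (map_mx f B)) -!map_mxM Dv.
  rewrite mulmxA (mulmx_M_E3 onE3) mulmxA B3v mul0mx !map_mx0 mulmx0.
  by rewrite scaler0 !addr0.
have /map_mx_inj E3v : map_mx f (E3 *m v^T) = map_mx f 0.
  by rewrite map_mx0 -(mulKmx uF (map_mx f _)) Fv mulmx0.
apply: trmx_inj; rewrite trmx0 -[LHS]mul1mx -onE3.1 -mulmxA.
by rewrite E3v mulmx0.
Qed.

Variable sqrtPhi : 'M[R]_m3.
Hypotheses (uPhi : Phi \in unitmx) (sqrtP : psd_sqrt Phi sqrtPhi).
Variables (k : nat) (Gamma : 'M[R]_(n + m1, k)).

Lemma tr_invmx_Phi : iPhi^T = iPhi.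
Proof. by rewrite trmx_inv -Phi33_gram trmx_mul trmxK. Qed.

Lemma tr_invmx_M1 : iM1^T = iM1.
Proof. by rewrite invmx_M1 trmx_mul trmxK. Qed.

Lemma tr_J_H : J^T *m H = - (E2 *m iD22 *m Psi + E1 *m iM1 *m D13).
Proof.
rewrite tr_col_mx mul_row_col /Phi23 invmx_M1 !trmx_mul linearB /=.
by rewrite !trmx_mul !trmxK tr_invmx_D22; mx_expand; mx_abel.
Qed.

Lemma M_invE : M_inv E1 E2 E3 Xi sqrtPhi = E3 *m iPhi *m E3^T.
Proof.
have [[trS _] SS] := sqrtP.
have uS : sqrtPhi \in unitmx by move: uPhi; rewrite -SS unitmx_mul => /andP[].
have -> : iPhi = invmx sqrtPhi *m invmx sqrtPhi.
  have PS : Phi *m (invmx sqrtPhi *m invmx sqrtPhi) = 1%:M.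
    by rewrite -SS mulmxA (mulmxK uS) mulmxV.
  by rewrite -[RHS](mulKmx uPhi) PS mulmx1.
have -> : M_inv E1 E2 E3 Xi sqrtPhi =
    (Xi *m invmx sqrtPhi *m E3^T)^T *m (Xi *m invmx sqrtPhi *m E3^T).
  rewrite /M_inv /K_inv !tr_row_mx !mul_row_col !mul0mx !add0r mulNmx.
  by rewrite [(- _)^T]linearN /= mulNmx mulmxN opprK.
rewrite !trmx_mul trmxK trmx_inv trS !mulmxA.
by rewrite -[_ *m Xi^T *m Xi]mulmxA Xi_orth mulmx1.
Qed.

Lemma B_invE : B_inv M D A B E1 E2 E3 K1 Gamma = Gamma^T *m L.
Proof.
rewrite /B_inv -mulmxA; congr (_ *m _).
rewrite !tr_row_mx !mul_col_mx !mul_row_col /full_input A_tilde_H.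
by rewrite !mul_col_mx add_col_mx; congr col_mx; mx_expand; mx_abel.
Qed.

(** The matrix that y is multiplied with in u = E_1 u_1 + E_2 u_2 + E_3 u_3, apart
    from the contribution of eta and the term with z: the first summand comes
    from solving for u_2, the second from H Phi_33^-1 y_3 as a part of xi, the
    third from solving for u_3. *)
Lemma D_invE : D_inv M D A B E1 E2 E3 K1 Xi =
  E2 *m iD22 *m E2^T + L^T *m H *m iPhi *m E3^T - E3 *m iPhi *m H^T *m J.
Proof.
have -> : L^T *m H = J^T *m H - E3 *m iPhi *m (H^T *m At *m H).
  rewrite /full_input linearD /= !trmx_mul !trmxK tr_invmx_Phi A_tilde_skew.
  by mx_expand; mx_abel.
have HJ : H^T *m J = - (D13^T *m iM1 *m E1^T) + Psi^T *m iD22 *m E2^T.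
  rewrite -[LHS]trmxK trmx_mul trmxK tr_J_H linearN linearD /=.
  rewrite [(E2 *m _ *m _)^T]trmx_mul [(E2 *m _)^T]trmx_mul tr_invmx_D22.
  rewrite [(E1 *m _ *m _)^T]trmx_mul [(E1 *m _)^T]trmx_mul tr_invmx_M1.
  by mx_expand; mx_abel.
rewrite -![_ *m H^T *m J]mulmxA HJ tr_J_H.
have D33 : iPhi *m Xi^T *m (B_tilde D B E1 E3 K1 Xi)^T *m At
    *m B_tilde D B E1 E3 K1 Xi *m Xi *m iPhi
    = iPhi *m (H^T *m At *m H) *m iPhi.
  by rewrite -B_tilde_Xi trmx_mul !mulmxA.
rewrite /D_inv {}D33; move: (H^T *m At *m H) Phi Psi M1 D22 => W F1 F2 F3 F4.
rewrite !tr_row_mx !mul_row_col !mul_mx_row !add_row_mx !mul_row_col.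
by mx_expand; mx_abel.
Qed.

(** A solution of the descriptor system solves F u = y, with [J^T *m xi] the part
    of u_1 and u_2 that depends on the state.  The scalars are extended by [f] so
    that [z] may be the indeterminate. *)
Lemma descriptor_inverse (K : fieldType) (f : {rmorphism R -> K}) (z : K) p
    (xi : 'M[K]_(n + m1, p)) (u3 : 'M[K]_(m3, p)) (y : 'M[K]_(m, p)) :
  z%:M - map_mx f A \in unitmx ->
  z *: xi = map_mx f At *m xi + map_mx f H *m u3 + map_mx f J *m y ->
  (map_mx f H)^T *m xi = map_mx f E3^T *m y ->
  (z *: map_mx f M + map_mx f D
     + (map_mx f B)^T *m invmx (z%:M - map_mx f A) *m map_mx f B)
    *m (map_mx f (E2 *m iD22 *m E2^T) *m y + (map_mx f J)^T *m xi
        + map_mx f E3 *m u3) = y.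
Proof.
move=> uA; rewrite -[xi]vsubmxK; move: (usubmx xi) (dsubmx xi) => x w.
rewrite /A_tilde map_block_mx mul_block_col scale_col_mx.
rewrite ![map_mx f (col_mx _ _)]map_col_mx !mul_col_mx !add_col_mx.
rewrite !tr_col_mx !mul_row_col => /eq_col_mx [eqx eqw] eq3.
(* The system (x, w) stores u_1 as w = K_1 u_1, and its X_2-equation is solved
   for u_2. *)
pose u1 := map_mx f iK1 *m w.
pose u2 := map_mx f iD22 *m
  (map_mx f E2^T *m y + map_mx f D12^T *m u1 - map_mx f B2^T *m x).
set U := (X in _ *m X = _).
have UE : U = map_mx f E1 *m u1 + map_mx f E2 *m u2 + map_mx f E3 *m u3.
  rewrite /U /u2 /u1 !map_trmx; congr (_ + _).
  rewrite !trmx_mul linearB /= !trmx_mul !trmxK tr_invmx_D22.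
  rewrite !(map_mxM, map_mxD, map_mxN).
  by mx_expand; mx_abel.
have D22u2 : map_mx f D22 *m u2 =
    map_mx f E2^T *m y + map_mx f D12^T *m u1 - map_mx f B2^T *m x.
  by rewrite mulmxA -map_mxM mulmxV // map_mx1 mul1mx.
have K1K : map_mx f K1^T *m map_mx f iK1T = 1%:M.
  by rewrite -map_mxM -trmx_mul mulVmx ?unitmx_K1 // trmx1 map_mx1.
have M1u1 : map_mx f M1 *m u1 = map_mx f K1^T *m w.
  by rewrite -K1_M1 mulmxA -map_mxM mulmxK // unitmx_K1.
have trM_E p' (E : 'M[R]_(m, p')) : M *m E = 0 -> E^T *m M = 0.
  by move/(congr1 trmx); rewrite trmx_mul symM trmx0.
have ME2 := mulmx_M_E2 onE2; have ME3 := mulmx_M_E3 onE3.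
rewrite UE; apply: (@mul_realization_eq _ _ _ _ _ _ _ _ _ _ _ _ _ _
  _ _ _ _ _ _ _ _ _ _ x) => //.
- rewrite !map_trmx -!map_mxM -!map_mxD.
  by rewrite (decomposition_id symM onE1 onE2 onE3) map_mx1.
- by rewrite -map_mxM ME2 map_mx0.
- by rewrite -map_mxM ME3 map_mx0.
- by rewrite map_trmx -map_mxM trM_E ?map_mx0.
- by rewrite map_trmx -map_mxM trM_E ?map_mx0.
- by rewrite map_trmx -!map_mxM (mulmx_E2T_D_E3 skewD onE2 onE3) map_mx0.
- by rewrite map_trmx -!map_mxM (mulmx_E3T_D_E2 skewD onE2 onE3) map_mx0.
- by rewrite map_trmx -!map_mxM (mulmx_E3T_D_E3 skewD onE3) map_mx0.
- rewrite {}eqx /u2 /u1 !(map_mxM, map_mxD, map_mxN).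
  by mx_expand; mx_abel.
- rewrite !map_trmx -!map_mxM M1u1 scalemxAr {}eqw ?map_trmx.
  rewrite !mulmxDr -!mulmxA; mx_expand.
  rewrite !(map_mxM, map_mxD, map_mxN); mx_expand.
  rewrite K1K !mul1mx /u2 /u1 !trmx_mul !map_mxM; mx_expand.
  by mx_abel.
- rewrite mulmxDr [_ *m (_ *m u2)]mulmxA !map_trmx -!map_mxM D22u2 ?map_trmx.
  rewrite !trmx_mul !trmxK skewD !(map_mxM, map_mxN); mx_expand.
  by mx_abel.
- move: eq3; rewrite [map_mx f (- _)]map_mxN [(- _)^T]linearN /=.
  rewrite !map_trmx -!map_mxM ?map_trmx !trmx_mul !trmxK skewD => <-.
  by rewrite !(map_mxM, map_mxN) /u1; mx_expand; mx_abel.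
Qed.

(** Up to [Gamma] this is the output map of the inverse system; its last term
    enters through u_3. *)
Lemma tr_full_input : L^T = J^T - E3 *m iPhi *m H^T *m At.
Proof.
rewrite /full_input linearD /= !trmx_mul !trmxK tr_invmx_Phi A_tilde_skew.
by mx_expand.
Qed.

Hypotheses (Gamma_H : Gamma^T *m H = 0)
  (split_id : Gamma *m Gamma^T + H *m iPhi *m H^T = 1%:M).

Local Notation Ai := (A_inv D A B E1 E2 K1 Gamma).
Local Notation Bi := (B_inv M D A B E1 E2 E3 K1 Gamma).
Local Notation Di := (D_inv M D A B E1 E2 E3 K1 Xi).
Local Notation Mi := (M_inv E1 E2 E3 Xi sqrtPhi).

(** Here [eta] is the state of the inverse system with input 1; it determines a
    solution of the descriptor system with right-hand side 1. *)
Lemma realization_mul_inverse (K : fieldType) (f : {rmorphism R -> K}) (z : K) :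
  z%:M - map_mx f A \in unitmx -> z%:M - map_mx f Ai \in unitmx ->
  (z *: map_mx f M + map_mx f D
     + (map_mx f B)^T *m invmx (z%:M - map_mx f A) *m map_mx f B)
  *m (z *: map_mx f Mi + map_mx f Di
     + (map_mx f Bi)^T *m invmx (z%:M - map_mx f Ai) *m map_mx f Bi) = 1%:M.
Proof.
move=> uA uAi.
set eta := invmx (z%:M - map_mx f Ai) *m map_mx f Bi.
have eqeta : z *: eta = map_mx f Ai *m eta + map_mx f Bi.
  have : (z%:M - map_mx f Ai) *m eta = map_mx f Bi by rewrite mulKVmx.
  by rewrite mulmxBl mul_scalar_mx => <-; rewrite addrC subrK.
have HG : H^T *m Gamma = 0.
  by rewrite -[LHS]trmxK trmx_mul trmxK Gamma_H trmx0.
set xi := map_mx f Gamma *m eta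
  + map_mx f H *m map_mx f iPhi *m map_mx f E3^T.
set u3 := map_mx f iPhi *m (z *: map_mx f E3^T
  - (map_mx f H)^T *m (map_mx f At *m xi + map_mx f J)).
have st : z *: xi = map_mx f At *m xi + map_mx f H *m u3 + map_mx f J.
  apply: zero_dynamics.
    by rewrite !map_trmx -!map_mxM -map_mxD split_id map_mx1.
  by rewrite eqeta map_trmx -!map_mxM -map_mxD -map_mxM B_invE.
have out : (map_mx f H)^T *m xi = map_mx f E3^T.
  rewrite mulmxDr !mulmxA map_trmx -!map_mxM HG Phi33_gram mulmxV //.
  by rewrite map_mx0 !mul0mx add0r map_mxM map_mx1 mul1mx.
rewrite -{1}[map_mx f E3^T]mulmx1 in out; rewrite -[map_mx f J]mulmx1 in st.
rewrite -[RHS](descriptor_inverse uA st out); congr (_ *m _).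
have -> : (map_mx f Bi)^T *m invmx (z%:M - map_mx f Ai) *m map_mx f Bi
    = map_mx f L^T *m (map_mx f Gamma *m eta).
  by rewrite -mulmxA -/eta mulmxA -map_mxM B_invE map_trmx trmx_mul trmxK.
have -> : map_mx f Gamma *m eta
    = xi - map_mx f H *m map_mx f iPhi *m map_mx f E3^T by rewrite /xi addrK.
have Lxi X :
    map_mx f L^T *m (X - map_mx f H *m map_mx f iPhi *m map_mx f E3^T)
    = (map_mx f J)^T *m X
      - map_mx f (E3 *m iPhi) *m (map_mx f H)^T *m map_mx f At *m X
      - map_mx f (L^T *m H *m iPhi *m E3^T).
  rewrite mulmxBr {1}tr_full_input !(map_mxM, map_mxD, map_mxN) ?map_trmx.
  by mx_expand; mx_abel.
rewrite Lxi /u3 M_invE D_invE {Lxi u3 st out}; move: {eqeta} xi => X.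
rewrite mulmx1 !(map_mxM, map_mxD, map_mxN) ?map_trmx.
mx_expand; rewrite -!scalemxAr; mx_expand.
by mx_abel.
Qed.

(** The three block columns of [B_inv] are read off by multiplying with E_1, E_2,
    E_3 on the right. *)
Lemma controllable_inverse :
  Gamma^T *m Gamma = 1%:M -> controllable A B -> controllable Ai Bi.
Proof.
move=> Gamma_on /controllableP ctrlAB; apply/controllableP => v vAB.
pose r j := v *m Ai ^+ j *m Gamma^T.
have rL j : r j *m L = 0 by rewrite /r -mulmxA -B_invE -mulmxA vAB.
have rH j : r j *m H = 0 by rewrite /r -mulmxA Gamma_H mulmx0.
have r_0 : r 0%N = v *m Gamma^T by rewrite /r expr0 mulmx1.
have r_S j : r j.+1 = r j *m At *m (Gamma *m Gamma^T).
  by rewrite /r exprSr -mulmxE /A_inv !mulmxA.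
clearbody r.
have [[E11 _] [E22 _] [E33 _]] := And3 onE1 onE2 onE3.
have E21 := mulmx_E2T_E1 onE1 onE2; have E31 := mulmx_E3T_E1 onE1 onE3.
have E32 := mulmx_E3T_E2 onE2 onE3.
have E12 : E1^T *m E2 = 0.
  by rewrite -[LHS]trmxK trmx_mul trmxK E21 trmx0.
have E13 : E1^T *m E3 = 0.
  by rewrite -[LHS]trmxK trmx_mul trmxK E31 trmx0.
have E23 : E2^T *m E3 = 0.
  by rewrite -[LHS]trmxK trmx_mul trmxK E32 trmx0.
have r0 j : rsubmx (r j) = 0.
  have := congr1 (mulmx^~ E1) (rL j); rewrite /= mul0mx /full_input /driven_input.
  rewrite mulmxDr mulmxDl -!mulmxA E31 !mulmx0 addr0 mul_col_mx.
  rewrite -[r j]hsubmxK mul_row_col row_mxKr.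
  rewrite -!mulmxA !mulmxBl -!mulmxA E21 E11 !mulmx0 add0r subr0 mulmx1.
  move/(congr1 (mulmx^~ K1^T)); rewrite /= mul0mx -mulmxA -trmx_mul.
  by rewrite mulmxV ?unitmx_K1 // trmx1 mulmx1.
pose x j := lsubmx (r j).
have rE j : r j = row_mx (x j) 0 by rewrite -[LHS]hsubmxK r0.
have xB2 j : x j *m B2 = 0.
  have := congr1 (mulmx^~ E2) (rL j); rewrite /= mul0mx /full_input /driven_input.
  rewrite mulmxDr mulmxDl -!mulmxA E32 !mulmx0 addr0 mul_col_mx rE.
  rewrite mul_row_col mul0mx addr0 -!mulmxA E22 mulmx1 !mulmxA.
  move/(congr1 (mulmx^~ D22)).
  rewrite /= mul0mx -[x j *m B *m E2 *m iD22 *m _]mulmxA mulVmx //.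
  by rewrite mulmx1 -mulmxA.
have rAH j : r j *m At *m H = 0.
  have := congr1 (mulmx^~ E3) (rL j); rewrite /= mul0mx /full_input /driven_input.
  rewrite mulmxDr mulmxDl -!mulmxA E33 mulmx1 mul_col_mx rE mul_row_col.
  rewrite mul0mx addr0 -!mulmxA E23 !mulmx0 add0r.
  by rewrite !mulmxA => /(congr1 (mulmx^~ Phi)); rewrite /= mul0mx mulmxKV.
have xB3 j : x j *m B3 = 0.
  by have := rH j; rewrite rE mul_row_col mul0mx addr0.
(* By [rAH] the projection Gamma Gamma^T inside A_inv acts trivially here. *)
have rS j : r j.+1 = r j *m At.
  rewrite -[RHS]mulmx1 -split_id mulmxDr !mulmxA rAH !mul0mx addr0.
  by rewrite r_S !mulmxA.
have xAB j : x j.+1 = x j *m A /\ x j *m B1 = 0.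
  have := rS j; rewrite !rE /A_tilde mul_row_block !mul0mx !addr0.
  rewrite mulmxBr mulmxDl mulmxDr !mulmxA -[x j *m B *m E2]mulmxA xB2.
  rewrite !mul0mx subr0 addr0.
  case/eq_row_mx => -> /esym/(congr1 (mulmx^~ K1)).
  by rewrite /= mul0mx -!mulmxA mulVmx ?unitmx_K1 // mulmx1.
have xE j : x j = x 0%N *m A ^+ j.
  elim: j => [|j IH]; first by rewrite expr0 mulmx1.
  by rewrite (xAB j).1 IH exprSr -mulmxE mulmxA.
have x0 : x 0%N = 0.
  apply: ctrlAB => j; rewrite mulmxA -xE -[LHS]mulmx1.
  rewrite -(decomposition_id symM onE1 onE2 onE3) !mulmxDr !mulmxA.
  by rewrite -![x j *m B *m _]mulmxA (xAB j).2 xB2 xB3 !mul0mx !addr0.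
have := rE 0%N; rewrite x0 row_mx0 r_0.
by move/(congr1 (mulmx^~ Gamma)); rewrite /= mul0mx -mulmxA Gamma_on mulmx1.
Qed.

End InverseData.

(** * The theorem *)

(** Its determinant is the characteristic polynomial, which is monic. *)
Lemma ratmx_resolvent_unit (R : rcfType) n (A : 'M[R]_n) :
  (FracField.tofrac 'X)%:M - ratmx A \in unitmx.
Proof.
have -> : (FracField.tofrac 'X)%:M - ratmx A =
    map_mx (@FracField.tofrac {poly R[i]})
      (char_poly_mx (map_mx (real_complex R) A)).
  by apply/matrixP => i j; rewrite !mxE rmorphB rmorphMn.
rewrite unitmxE det_map_mx unitfE tofrac_eq0.
by rewrite monic_neq0 // char_poly_monic.
Qed.

Theorem theorem5p6 (R : realType) (n m m1 m2 m3 k : nat)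
    (M D : 'M[R]_m) (A : 'M[R]_n) (B : 'M[R]_(n, m))
    (E1 : 'M[R]_(m, m1)) (E2 : 'M[R]_(m, m2)) (E3 : 'M[R]_(m, m3))
    (K1 : 'M[R]_m1) (Xi : 'M[R]_m3) (Gamma : 'M[R]_(n + m1, k))
    (sqrtPhi33 : 'M[R]_m3) :
  PRO (realization M D A B) ->
  psd M -> A^T = - A -> D^T = - D -> controllable A B ->
  orthonormal_basis E1 (space1 M) ->
  orthonormal_basis E2 (space2 M D) ->
  orthonormal_basis E3 (space3 M D) ->
  \det (realization M D A B) != 0 ->
  K1^T *m K1 = block_M1 M E1 ->
  Xi^T *m Xi = 1%:M ->
  k = (n + m1 - m3)%N ->
  Gamma^T *m Gamma = 1%:M ->
  Gamma^T *m B_tilde D B E1 E3 K1 Xi = 0 ->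
  psd_sqrt (Phi33 M D B E1 E3) sqrtPhi33 ->
  invmx (realization M D A B) =
    realization (M_inv E1 E2 E3 Xi sqrtPhi33)
                (D_inv M D A B E1 E2 E3 K1 Xi)
                (A_inv D A B E1 E2 K1 Gamma)
                (B_inv M D A B E1 E2 E3 K1 Gamma)
  /\ controllable (A_inv D A B E1 E2 K1 Gamma)
                  (B_inv M D A B E1 E2 E3 K1 Gamma).
Proof.
move=> _ [symM _] skewA skewD ctrlAB onE1 onE2 onE3 detF K1_M1 Xi_orth k_def.
move=> Gamma_on Gamma_Bt sqrtP.
pose f : {rmorphism R -> {fraction {poly R[i]}}} :=
  @FracField.tofrac {poly R[i]} \o polyC \o real_complex R.
have realE p q N' P' (C : 'M[R]_p) (G : 'M[R]_(p, q)) :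
    realization N' P' C G =
    FracField.tofrac 'X *: map_mx f N' + map_mx f P' + (map_mx f G)^T
    *m invmx ((FracField.tofrac 'X)%:M - map_mx f C) *m map_mx f G.
  by rewrite [(map_mx f G)^T]map_trmx.
have res_unit p (C : 'M[R]_p) :
    (FracField.tofrac 'X)%:M - map_mx f C \in unitmx.
  exact: (ratmx_resolvent_unit C).
have uF : realization M D A B \in unitmx by rewrite unitmxE unitfE.
have uPhi : Phi33 M D B E1 E3 \in unitmx.
  by move: uF; rewrite realE; apply: (unitmx_Phi33 symM skewD onE1 onE2 onE3 K1_M1).
set H := constraint_input D B E1 E3 K1.
have HH : H^T *m H = Phi33 M D B E1 E3 := Phi33_gram B symM onE1 onE2 onE3 K1_M1.
have m3_le : (m3 <= n + m1)%N.
  rewrite -(mxrank_unit uPhi) -HH.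
  exact: leq_trans (mxrankM_maxr _ _) (rank_leq_row _).
have Gamma_H : Gamma^T *m H = 0.
  by rewrite /H -(B_tilde_Xi D B E1 E3 K1 Xi_orth) mulmxA Gamma_Bt mul0mx.
have split_id : Gamma *m Gamma^T + H *m invmx (Phi33 M D B E1 E3) *m H^T = 1%:M.
  by rewrite -HH; apply: tall_split_id; rewrite ?HH // k_def subnK.
split; last first.
  exact: (controllable_inverse symM skewD onE1 onE2 onE3 K1_M1 uPhi
    Gamma_H split_id).
have FG : realization M D A B *m
    realization (M_inv E1 E2 E3 Xi sqrtPhi33) (D_inv M D A B E1 E2 E3 K1 Xi)
      (A_inv D A B E1 E2 K1 Gamma) (B_inv M D A B E1 E2 E3 K1 Gamma) = 1%:M.
  rewrite [realization M D A B]realE.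
  rewrite [realization _ _ (A_inv _ _ _ _ _ _ _) _]realE.
  exact: (realization_mul_inverse symM skewA skewD onE1 onE2 onE3 K1_M1 Xi_orth
    uPhi sqrtP Gamma_H split_id (res_unit _ A) (res_unit _ _)).
by rewrite -[LHS]mulmx1 -FG mulKmx.
Qed.
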